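(* Let $ABC$ be a nondegenerate triangle with semiperimeter $s$, inradius $r$ and circumradius $R$. Then $$R-2r=\frac1R\,\mathrm{ELD}_I(1),$$ $$4R^2+4Rr+3r^2-s^2=\mathrm{ELD}_I(0),$$ $$s^2-r(16R-5r)=9\,\mathrm{ELD}_I\!\left(\tfrac23\right),$$ $$4R+r-\sqrt3\,s=\frac{\mathrm{ELD}_I(2)}{4R+r+\sqrt3\,s}.$$
   Context: Let $I$, $O$, $H$ be the incenter, circumcenter and orthocenter of $ABC$. For real $\lambda$, $\mathrm{ELD}_I(\lambda)=|XI|^2$ where $X=(1-\lambda)H+\lambda O$ (affine combination), a point on the Euler line. *)

(* Defs.v *)
(* Euclidean plane geometry over K : realType, in MathComp; points of the
   plane are row vectors 'rV[K]_2. *)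
From HB Require Import structures.
From mathcomp Require Import all_boot all_order all_algebra.
From mathcomp Require Import reals.

Set Implicit Arguments.
Unset Strict Implicit.
Unset Printing Implicit Defensive.

Import Order.TTheory GRing.Theory Num.Theory.
Local Open Scope ring_scope.

Definition dot (K : realType) (u v : 'rV[K]_2) : K :=
  \sum_(i < 2) u 0 i * v 0 i.

(* Not the norm that MathComp-Analysis puts on row vectors, which is the
   sup norm. *)
Definition dist (K : realType) (P Q : 'rV[K]_2) : K :=
  Num.sqrt (dot (P - Q) (P - Q)).

(* A, B, C are not collinear: B - A and C - A are linearly independent. *)
Definition nondegenerate_triangle (K : realType) (A B C : 'rV[K]_2) : Prop :=
  row_free (col_mx (B - A) (C - A)).

Definition semiperimeter (K : realType) (A B C : 'rV[K]_2) : K :=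
  (dist B C + dist C A + dist A B) / 2.

Definition on_segment (K : realType) (X Y T : 'rV[K]_2) : Prop :=
  exists t : K, [/\ 0 <= t, t <= 1 & T = (1 - t) *: X + t *: Y].

(* The circle of center P and radius r is tangent to the line XY (the radius
   to the point of contact T is perpendicular to it), at a point T of the
   segment [X, Y]. *)
Definition touches_side (K : realType) (P : 'rV[K]_2) (r : K)
    (X Y : 'rV[K]_2) : Prop :=
  exists T : 'rV[K]_2,
    [/\ on_segment X Y T, dist P T = r & dot (P - T) (Y - X) = 0].

(* The circle of center P and radius r is inscribed in ABC: P is the incenter
   and r the inradius. Contact with the sides themselves, rather than with the
   lines carrying them, excludes the three excircles. *)
Definition is_incircle (K : realType) (A B C P : 'rV[K]_2) (r : K) : Prop :=
  0 < r /\
  [/\ touches_side P r B C, touches_side P r C A & touches_side P r A B].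

(* P is the circumcenter and rho the circumradius. *)
Definition is_circumcircle (K : realType) (A B C P : 'rV[K]_2) (rho : K)
    : Prop :=
  [/\ dist P A = rho, dist P B = rho & dist P C = rho].

(* P lies on the three altitudes. *)
Definition is_orthocenter (K : realType) (A B C P : 'rV[K]_2) : Prop :=
  [/\ dot (P - A) (C - B) = 0,
      dot (P - B) (A - C) = 0 &
      dot (P - C) (B - A) = 0].

Definition euler_line_point (K : realType) (O H : 'rV[K]_2) (lambda : K)
    : 'rV[K]_2 :=
  (1 - lambda) *: H + lambda *: O.

Definition ELD (K : realType) (I O H : 'rV[K]_2) (lambda : K) : K :=
  dist (euler_line_point O H lambda) I ^+ 2.

(* Main.v *)
Require Import Defs.
From HB Require Import structures.
From mathcomp Require Import all_boot all_order all_algebra.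
From mathcomp Require Import reals.
From mathcomp Require Import ring lra.

Set Implicit Arguments.
Unset Strict Implicit.
Unset Printing Implicit Defensive.

Import Order.TTheory GRing.Theory Num.Theory.
Local Open Scope ring_scope.

(** For fixed triangle, the squared distance from the incenter to the Euler line point is a
    quadratic polynomial in [lambda], with coefficients combining [R ^+ 2], [R * r], [r ^+ 2] and
    [s ^+ 2] ([ELD_formula]); the four identities are its values at [1], [0], [2 / 3] and [2].

    To obtain it, take [A] as origin and [B - A], [C - A] as basis, and express all inner products
    through the lengths [x, y, z] of the tangents from [A, B, C] to the incircle. The incenter is
    given by its barycentric coordinates ([incenter_barycentric]), the circumcenter by its
    projections on two sides, and the orthocenter by Sylvester's relation
    ([orthocenter_circumcenter]). The radii enter through Heron's formula
    ([tangent_lengths_inradius]) and through area = abc / 4R ([inradius_circumradius]). *)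

(** * Inner products and nondegeneracy *)

Lemma dotE (K : realType) (u v : 'rV[K]_2) :
  dot u v = u 0 0 * v 0 0 + u 0 1 * v 0 1.
Proof.
by rewrite /dot big_ord_recl big_ord1; congr (_ + u 0 _ * v 0 _); apply: val_inj.
Qed.

Lemma dot_ge0 (K : realType) (u : 'rV[K]_2) : 0 <= dot u u.
Proof. by rewrite dotE -!expr2 addr_ge0 ?sqr_ge0. Qed.

Lemma dotC (K : realType) (u v : 'rV[K]_2) : dot u v = dot v u.
Proof. by rewrite !dotE; ring. Qed.

Lemma dotDr (K : realType) (u v w : 'rV[K]_2) :
  dot u (v + w) = dot u v + dot u w.
Proof. by rewrite !dotE !mxE; ring. Qed.

Lemma dotZr (K : realType) (a : K) (u v : 'rV[K]_2) :
  dot u (a *: v) = a * dot u v.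
Proof. by rewrite !dotE !mxE; ring. Qed.

Lemma sqr_dot_le (K : realType) (u v : 'rV[K]_2) :
  dot u v ^+ 2 <= dot u u * dot v v.
Proof.
rewrite -subr_ge0.
have -> : dot u u * dot v v - dot u v ^+ 2 =
    (u 0 0 * v 0 1 - u 0 1 * v 0 0) ^+ 2 by rewrite !dotE; ring.
exact: sqr_ge0.
Qed.

Lemma dist_ge0 (K : realType) (P Q : 'rV[K]_2) : 0 <= dist P Q.
Proof. exact: sqrtr_ge0. Qed.

Lemma sqr_dist (K : realType) (P Q : 'rV[K]_2) :
  dist P Q ^+ 2 = dot (P - Q) (P - Q).
Proof. by rewrite sqr_sqrtr ?dot_ge0. Qed.

Lemma distC (K : realType) (P Q : 'rV[K]_2) : dist P Q = dist Q P.
Proof. by rewrite /dist !dotE !mxE; congr Num.sqrt; ring. Qed.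

(** This Gram determinant is the square of the determinant of [B - A] and [C - A], whose vanishing
    would yield a linear dependence between them. *)
Lemma nondegenerate_gram (K : realType) (A B C : 'rV[K]_2) :
  nondegenerate_triangle A B C ->
  0 < dist A B ^+ 2 * dist A C ^+ 2 - dot (B - A) (C - A) ^+ 2.
Proof.
move=> ABC; set u := B - A; set v := C - A.
have -> : dist A B ^+ 2 * dist A C ^+ 2 - dot u v ^+ 2 =
    (u 0 0 * v 0 1 - u 0 1 * v 0 0) ^+ 2.
  by rewrite !sqr_dist !dotE /u /v !mxE; ring.
rewrite lt0r sqr_ge0 andbT sqrf_eq0 -/(_ != 0).
apply: contraTneq ABC => det0.
rewrite /nondegenerate_triangle -/u -/v; move: u v det0 => u v det0.
apply/negP => /row_free_inj inj.
have inj0 (p q : K) : p *: u + q *: v = 0 -> p = 0 /\ q = 0.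
  move=> pq0; have /inj : row_mx p%:M q%:M *m col_mx u v = 0 *m col_mx u v.
    by rewrite mul0mx mul_row_col !mul_scalar_mx.
  rewrite -[0]row_mx0 => /eq_row_mx[/matrixP/(_ 0 0) + /matrixP/(_ 0 0)].
  by rewrite !mxE !mulr1n.
have vec0 (w : 'rV[K]_2) : w 0 0 = 0 -> w 0 1 = 0 -> w = 0.
  move=> w0 w1; apply/rowP; case=> [[|[|//]] lti]; rewrite [RHS]mxE.
    by rewrite -[RHS]w0; congr (w _ _); apply: val_inj.
  by rewrite -[RHS]w1; congr (w _ _); apply: val_inj.
(* Both coordinates of [v 0 1 *: u - u 0 1 *: v] vanish, the first because it is the determinant;
   independence then kills its coefficients. The same with the other coordinates leaves [v = 0]. *)
have [] := inj0 (v 0 1) (- u 0 1); first by apply: vec0; rewrite !mxE; lra.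
move=> v1 /eqP; rewrite oppr_eq0 => /eqP u1.
have [] := inj0 (v 0 0) (- u 0 0); first by apply: vec0; rewrite !mxE; lra.
move=> v0 _; have v_eq0 : v = 0 by exact: vec0.
have [|_ /eqP] := inj0 0 1; first by rewrite v_eq0 scaler0 scale0r addr0.
by rewrite oner_eq0.
Qed.

(** * Tangent lengths and the incenter *)

(** Pythagoras in the two right triangles cut off by the radius to the contact point; [x] and [y]
    are the distances from that point to [X] and [Y]. *)
Lemma touches_side_lengths (K : realType) (P X Y : 'rV[K]_2) (r : K) :
  touches_side P r X Y ->
  exists x y : K, [/\ 0 <= x, 0 <= y, dist X Y = x + y,
    dist P X ^+ 2 = r ^+ 2 + x ^+ 2 & dist P Y ^+ 2 = r ^+ 2 + y ^+ 2].
Proof.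
case=> T [[t [t0 t1 eqT]] <- PT].
exists (t * dist X Y), ((1 - t) * dist X Y).
rewrite !exprMn !sqr_dist; split.
- by rewrite mulr_ge0 ?dist_ge0.
- by rewrite mulr_ge0 ?dist_ge0 ?subr_ge0.
- by ring.
- transitivity (dot (P - T) (P - T) + t ^+ 2 * dot (X - Y) (X - Y)
    + 2 * t * dot (P - T) (Y - X)); last by rewrite PT mulr0 addr0.
  by rewrite eqT !dotE !mxE; ring.
- transitivity (dot (P - T) (P - T) + (1 - t) ^+ 2 * dot (X - Y) (X - Y)
    - 2 * (1 - t) * dot (P - T) (Y - X)); last by rewrite PT mulr0 subr0.
  by rewrite eqT !dotE !mxE; ring.
Qed.

(** [x], [y], [z] stand for the tangent lengths from [A], [B], [C]. Only distances are recorded; the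
    contact points are forgotten and signs are kept apart. *)
Definition tangent_lengths (K : realType) (A B C P : 'rV[K]_2) (r x y z : K) :
    Prop :=
  [/\ dist B C = y + z, dist C A = z + x & dist A B = x + y] /\
  [/\ dist P A ^+ 2 = r ^+ 2 + x ^+ 2, dist P B ^+ 2 = r ^+ 2 + y ^+ 2
    & dist P C ^+ 2 = r ^+ 2 + z ^+ 2].

(** The two tangents from a vertex are equally long: both lengths are nonnegative with the same
    square, the power of the vertex. *)
Lemma incircle_tangent_lengths (K : realType) (A B C P : 'rV[K]_2) (r : K) :
  is_incircle A B C P r ->
  exists x y z : K, [/\ 0 <= x, 0 <= y & 0 <= z] /\
    tangent_lengths A B C P r x y z.
Proof.
case=> _ [/touches_side_lengths[y [z [y0 z0 BC PB PC]]]].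
move=> /touches_side_lengths[z' [x [z'0 x0 CA PC' PA]]].
move=> /touches_side_lengths[x' [y' [x'0 y'0 AB PA' PB']]].
have eq_len (p q : K) : 0 <= p -> 0 <= q ->
    r ^+ 2 + p ^+ 2 = r ^+ 2 + q ^+ 2 -> p = q.
  by move=> p0 q0 /addrI/eqP; rewrite eqrXn2 // => /eqP.
have zz : z' = z by apply: eq_len => //; rewrite -PC -PC'.
have xx : x' = x by apply: eq_len => //; rewrite -PA -PA'.
have yy : y' = y by apply: eq_len => //; rewrite -PB -PB'.
by exists x, y, z; subst.
Qed.

(** Cramer's rule in the basis [B - A], [C - A]. Vector identities below are proved by testing them
    against these two vectors. *)
Lemma eq_dot (K : realType) (A B C w w' : 'rV[K]_2) :
  nondegenerate_triangle A B C ->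
  dot (B - A) w = dot (B - A) w' -> dot (C - A) w = dot (C - A) w' -> w = w'.
Proof.
move=> /nondegenerate_gram; rewrite !sqr_dist.
have -> : dot (A - B) (A - B) * dot (A - C) (A - C) - dot (B - A) (C - A) ^+ 2 =
    ((B - A) 0 0 * (C - A) 0 1 - (B - A) 0 1 * (C - A) 0 0) ^+ 2.
  by rewrite !dotE !mxE; ring.
move: (B - A) (C - A) => u v; rewrite lt0r sqrf_eq0 => /andP[det0 _].
rewrite !dotE => wu wv.
have w0 : w 0 0 = w' 0 0.
  apply: (mulfI det0).
  by have := congr1 ( *%R (v 0 1)) wu; have := congr1 ( *%R (u 0 1)) wv; lra.
have w1 : w 0 1 = w' 0 1.
  apply: (mulfI det0).
  by have := congr1 ( *%R (v 0 0)) wu; have := congr1 ( *%R (u 0 0)) wv; lra.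
apply/rowP; case=> [[|[|//]] lti].
  by move: w0; congr (w _ _ = w' _ _); apply: val_inj.
by move: w1; congr (w _ _ = w' _ _); apply: val_inj.
Qed.

(** Polarization (the law of cosines) recovers the mixed products from the distances. *)
Lemma tangent_lengths_dot (K : realType) (A B C P : 'rV[K]_2) (r x y z : K) :
  tangent_lengths A B C P r x y z ->
  [/\ dot (B - A) (B - A) = (x + y) ^+ 2, dot (C - A) (C - A) = (z + x) ^+ 2
    & dot (B - A) (C - A) = x ^+ 2 + x * y + x * z - y * z] /\
  [/\ dot (P - A) (P - A) = r ^+ 2 + x ^+ 2,
      dot (B - A) (P - A) = x * (x + y) & dot (C - A) (P - A) = x * (z + x)].
Proof.
case=> -[/(congr1 (fun t => t ^+ 2)) + /(congr1 (fun t => t ^+ 2)) +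
  /(congr1 (fun t => t ^+ 2))].
rewrite !sqr_dist => BC CA AB [PA PB PC].
do 2?split => //.
- by rewrite -AB !dotE !mxE; ring.
- by move: BC CA AB; rewrite !dotE !mxE; lra.
- by move: AB PA PB; rewrite !dotE !mxE; lra.
- by move: CA PA PC; rewrite !dotE !mxE; lra.
Qed.

(** The incenter has barycentric weights BC : CA : AB, and [2 * (x + y + z)] is the perimeter. *)
Lemma incenter_barycentric (K : realType) (A B C P : 'rV[K]_2) (r x y z : K) :
  nondegenerate_triangle A B C -> tangent_lengths A B C P r x y z ->
  (2 * (x + y + z)) *: (P - A) = (z + x) *: (B - A) + (x + y) *: (C - A).
Proof.
move=> ABC /tangent_lengths_dot[[uu vv uv] [_ pu pv]].
apply: (eq_dot ABC); move: (P - A) (B - A) (C - A) uu vv uv pu pv => p u v uu vv.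
  by move=> uv pu _; rewrite !(dotDr, dotZr) pu uu uv; ring.
by rewrite dotC => vu _ pv; rewrite !(dotDr, dotZr) pv vv vu; ring.
Qed.

(** Heron's formula divided by [s], obtained by pairing the barycentric relation with [P - A]. *)
Lemma tangent_lengths_inradius (K : realType) (A B C P : 'rV[K]_2)
    (r x y z : K) :
  nondegenerate_triangle A B C -> tangent_lengths A B C P r x y z ->
  (x + y + z) * r ^+ 2 = x * y * z.
Proof.
move=> ABC len; have [_ [pp]] := tangent_lengths_dot len.
have := incenter_barycentric ABC len.
move: (P - A) (B - A) (C - A) pp => p u v pp e; rewrite !(dotC _ p) => pu pv.
by have := congr1 (dot p) e; rewrite !(dotDr, dotZr) pp pu pv; lra.
Qed.

(** By Heron, four times this product is the Gram determinant of [B - A] and [C - A]. *)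
Lemma tangent_lengths_gt0 (K : realType) (A B C P : 'rV[K]_2)
    (r x y z : K) :
  nondegenerate_triangle A B C -> tangent_lengths A B C P r x y z ->
  0 < (x + y + z) * (x * y * z).
Proof.
move=> ABC len; have [[uu vv uv] _] := tangent_lengths_dot len.
have := nondegenerate_gram ABC.
have [[_ CA AB] _] := len; rewrite AB (distC A) CA uv; lra.
Qed.

(** * Circumcenter, orthocenter and the Euler line *)

(** The circumcenter projects onto the midpoints of the sides. *)
Lemma circumcenter_dot (K : realType) (A B C O : 'rV[K]_2) (R : K) :
  is_circumcircle A B C O R ->
  [/\ dot (O - A) (O - A) = R ^+ 2,
      dot (B - A) (O - A) = dot (B - A) (B - A) / 2
    & dot (C - A) (O - A) = dot (C - A) (C - A) / 2].
Proof.
case=> /(congr1 (fun t => t ^+ 2)) + /(congr1 (fun t => t ^+ 2)) +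
  /(congr1 (fun t => t ^+ 2)).
rewrite !sqr_dist => OA OB OC; split=> //.
  by move: OA OB; rewrite !dotE !mxE; lra.
by move: OA OC; rewrite !dotE !mxE; lra.
Qed.

(** If [R = 0], Cauchy-Schwarz makes the product of [B - A] and [O - A] vanish; it is half the
    square of AB, so the Gram determinant could not be positive. *)
Lemma circumradius_neq0 (K : realType) (A B C O : 'rV[K]_2) (R : K) :
  nondegenerate_triangle A B C -> is_circumcircle A B C O R -> R != 0.
Proof.
move=> /nondegenerate_gram + /circumcenter_dot[oo ou _].
rewrite distC sqr_dist; apply: contraTneq => R0.
have := sqr_dot_le (B - A) (O - A); rewrite oo R0 expr0n mulr0 ou.
rewrite le_eqVlt ltNge sqr_ge0 orbF sqrf_eq0 mulf_eq0 invr_eq0 pnatr_eq0 orbF.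
by move=> /eqP ->; rewrite mul0r sub0r oppr_gt0 ltNge sqr_ge0.
Qed.

(** The square of 4 R area = abc. Solving the Gram system for [O - A] and pairing the solution with
    [O - A] itself gives [R ^+ 2]. *)
Lemma sqr_circumradius (K : realType) (A B C P O : 'rV[K]_2)
    (r R x y z : K) :
  nondegenerate_triangle A B C -> tangent_lengths A B C P r x y z ->
  is_circumcircle A B C O R ->
  16 * ((x + y + z) * (x * y * z)) * R ^+ 2 =
    ((x + y) * (y + z) * (z + x)) ^+ 2.
Proof.
move=> ABC len /circumcenter_dot[oo].
have [[uu vv uv] _] := tangent_lengths_dot len.
rewrite uu vv => ou ov.
(* [D] is the Gram determinant and [n] the product of [B - A] and [C - A]; the coefficients that
   follow come from Cramer's rule. *)
pose D : K := 4 * ((x + y + z) * (x * y * z)).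
pose n : K := x ^+ 2 + x * y + x * z - y * z.
have : (2 * D) *: (O - A) = ((z + x) ^+ 2 * ((x + y) ^+ 2 - n)) *: (B - A)
    + ((x + y) ^+ 2 * ((z + x) ^+ 2 - n)) *: (C - A).
  apply: (eq_dot ABC).
    move: (O - A) (B - A) (C - A) uu uv ou => o u v uu uv ou.
    by rewrite !(dotDr, dotZr) ou uu uv /D /n; field.
  move: (O - A) (B - A) (C - A) vv uv ov => o u v vv; rewrite dotC => vu ov.
  by rewrite !(dotDr, dotZr) ov vv vu /D /n; field.
move: (O - A) (B - A) (C - A) oo ou ov => o u v oo.
rewrite !(dotC _ o) => ou ov /(congr1 (dot o)).
by rewrite !(dotDr, dotZr) oo ou ov /D /n; lra.
Qed.

(** Both sides are nonnegative, so it suffices to compare squares, where the two previous formulas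
    for the radii apply. *)
Lemma inradius_circumradius (K : realType) (A B C P O : 'rV[K]_2)
    (r R x y z : K) :
  nondegenerate_triangle A B C -> tangent_lengths A B C P r x y z ->
  is_circumcircle A B C O R -> 0 <= x -> 0 <= y -> 0 <= z -> 0 <= r ->
  4 * (x + y + z) * r * R = (x + y) * (y + z) * (z + x).
Proof.
move=> ABC len OR x0 y0 z0 r0.
have R0 : 0 <= R by case: OR => <- _ _; exact: dist_ge0.
apply/eqP; rewrite -(@eqrXn2 _ 2) ?mulr_ge0 ?addr_ge0 ?ler0n //.
rewrite -(sqr_circumradius ABC len OR) -(tangent_lengths_inradius ABC len).
by apply/eqP; ring.
Qed.

(** Sylvester's relation OH = OA + OB + OC, rewritten with origin [A]. *)
Lemma orthocenter_circumcenter (K : realType) (A B C O H : 'rV[K]_2) (R : K) :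
  nondegenerate_triangle A B C -> is_circumcircle A B C O R ->
  is_orthocenter A B C H ->
  H - A = (B - A) + (C - A) - 2 *: (O - A).
Proof.
move=> ABC [OA OB OC] [HA HB HC].
have {}OB : dot (O - B) (O - B) = dot (O - A) (O - A).
  by rewrite -!sqr_dist OA OB.
have {}OC : dot (O - C) (O - C) = dot (O - A) (O - A).
  by rewrite -!sqr_dist OA OC.
apply: (eq_dot ABC); first by move: HC OB; rewrite !dotE !mxE; lra.
by move: HB OC; rewrite !dotE !mxE; lra.
Qed.

(* Since H - A = (B - A) + (C - A) - 2 (O - A), every point of the Euler line
   is an affine combination of A, B, C and O. The products of these vectors
   and of I - A are polynomials in R^2 and the tangent lengths x, y, z, except
   for (I - A).(O - A), where the barycentric coordinates of I bring in a
   denominator s = x + y + z; there s r^2 = x y z and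
   4 s r R = (x + y) (y + z) (z + x). *)
Lemma ELD_formula (K : realType) (A B C I O H : 'rV[K]_2) (s r R lambda : K) :
  nondegenerate_triangle A B C ->
  s = semiperimeter A B C ->
  is_incircle A B C I r ->
  is_circumcircle A B C O R ->
  is_orthocenter A B C H ->
  ELD I O H lambda =
    (3 * lambda - 2) ^+ 2 * R ^+ 2
    + (8 * lambda ^+ 2 - 14 * lambda + 4) * (R * r)
    + (2 * lambda - 3) * (lambda - 1) * r ^+ 2
    - (2 * lambda - 1) * (lambda - 1) * s ^+ 2.
Proof.
move=> ABC sE Ir OR Ho; have r0 : 0 < r by case: Ir.
have [x [y [z [[x0 y0 z0] len]]]] := incircle_tangent_lengths Ir.
have {sE} -> : s = x + y + z.
  by rewrite sE /semiperimeter; case: len => -[-> -> ->] _; field.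
have s_neq0 : x + y + z != 0.
  by apply: contraTneq (tangent_lengths_gt0 ABC len) => ->; rewrite mul0r ltxx.
have rE : r ^+ 2 = x * y * z / (x + y + z).
  by rewrite -(tangent_lengths_inradius ABC len) mulrAC divff // mul1r.
have RrE : R * r = (x + y) * (y + z) * (z + x) / (4 * (x + y + z)).
  by rewrite -(inradius_circumradius ABC len OR x0 y0 z0 (ltW r0)); field.
have [[uu vv uv] [pp pu pv]] := tangent_lengths_dot len.
have [oo] := circumcenter_dot OR; rewrite uu vv => ou ov.
have op : dot (O - A) (I - A) =
    (x + y) * (z + x) * (2 * x + y + z) / (4 * (x + y + z)).
  have := incenter_barycentric ABC len.
  move: (O - A) (I - A) (B - A) (C - A) ou ov => o p u v.
  rewrite !(dotC _ o) => ou ov /(congr1 (dot o)).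
  rewrite !(dotDr, dotZr) ou ov => e.
  apply: (mulfI (_ : 2 * (x + y + z) != 0)); first by rewrite mulf_neq0 ?pnatr_eq0.
  by rewrite e; field.
(* The coefficient of [O - A] adds [lambda] from [O] and [-2 * (1 - lambda)] from [H]; it vanishes
   at the centroid, [lambda = 2 / 3]. *)
have XE : euler_line_point O H lambda - I =
    (1 - lambda) *: ((B - A) + (C - A)) + (3 * lambda - 2) *: (O - A) - (I - A).
  rewrite /euler_line_point -[H](subrK A) (orthocenter_circumcenter ABC OR Ho).
  by apply/rowP => i; rewrite !mxE; ring.
rewrite /ELD sqr_dist XE.
move: (O - A) (I - A) (B - A) (C - A) uu vv uv pp pu pv oo ou ov op => {XE}.
move=> o p u v uu vv uv pp pu pv oo ou ov op.
have -> : dot ((1 - lambda) *: (u + v) + (3 * lambda - 2) *: o - p)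
              ((1 - lambda) *: (u + v) + (3 * lambda - 2) *: o - p) =
  (1 - lambda) ^+ 2 * (dot u u + dot v v + 2 * dot u v)
  + (3 * lambda - 2) ^+ 2 * dot o o + dot p p
  + 2 * (1 - lambda) * (3 * lambda - 2) * (dot u o + dot v o)
  - 2 * (1 - lambda) * (dot u p + dot v p) - 2 * (3 * lambda - 2) * dot o p.
  by rewrite !dotE !mxE; ring.
(* With [R * r] and [r ^+ 2] eliminated, a rational identity in [x, y, z, lambda, R] remains, with
   denominators nonzero by [s_neq0]. *)
by rewrite uu vv uv pp pu pv oo ou ov op RrE rE; field.
Qed.

Theorem mainTheorem12 (K : realType) (A B C I O H : 'rV[K]_2) (s r R : K) :
  nondegenerate_triangle A B C ->
  s = semiperimeter A B C ->
  is_incircle A B C I r ->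
  is_circumcircle A B C O R ->
  is_orthocenter A B C H ->
  [/\ R - 2 * r = 1 / R * ELD I O H 1,
      4 * R ^+ 2 + 4 * R * r + 3 * r ^+ 2 - s ^+ 2 = ELD I O H 0,
      s ^+ 2 - r * (16 * R - 5 * r) = 9 * ELD I O H (2 / 3) &
      4 * R + r - Num.sqrt 3 * s
        = ELD I O H 2 / (4 * R + r + Num.sqrt 3 * s)].
Proof.
move=> ABC sE Ir OR Ho.
have ELDE lambda := ELD_formula lambda ABC sE Ir OR Ho.
have r0 : 0 < r by case: Ir.
have s0 : 0 <= s by rewrite sE divr_ge0 ?addr_ge0 ?dist_ge0.
have R_ge0 : 0 <= R by case: OR => <- _ _; exact: dist_ge0.
have R_neq0 : R != 0 by exact: circumradius_neq0 ABC OR.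
have sqrt3 : Num.sqrt 3 ^+ 2 = 3 :> K by rewrite sqr_sqrtr.
split; rewrite ELDE; [by field | by ring | by field |].
have den0 : 0 < 4 * R + r + Num.sqrt 3 * s.
  by rewrite ltr_wpDr ?mulr_ge0 ?sqrtr_ge0 // ltr_wpDl ?mulr_ge0.
apply/(canRL (mulfK (lt0r_neq0 den0))).
(* Difference of squares; [Num.sqrt 3] stays a formal symbol for [ring] until its square is replaced
   by 3. *)
transitivity ((4 * R + r) ^+ 2 - Num.sqrt 3 ^+ 2 * s ^+ 2); first by ring.
by rewrite sqrt3; ring.
Qed.
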